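(* Let $g:\mathbb{R}^K\to\mathbb{R}$ be convex and twice differentiable with Lipschitz gradient, and let $(x^{(r)})_{r\ge0}$ be generated by the cyclic coordinate gradient descent (CGD) method with inverse stepsizes $P_k\ge L_k$, $P_k>0$, applied to $\min_{x\in\mathbb{R}^K}g(x)$. Suppose $\beta\in\mathbb{R}_+$ satisfies $$\|H(\xi)\|\le\beta\qquad\text{for all }\xi_2,\dots,\xi_K\in\mathbb{R}^K.$$ Then for every optimal solution $x^*$, $$g(x^{(r)})-g(x^* )\le 2\left(P_{\max}+\frac{\beta^2}{P_{\min}}\right)\frac{R_0^2}{r},\qquad\forall\, r\ge1.$$
   Context: Write $H_{ij}(x)=\frac{\partial^2g}{\partial x_i\partial x_j}(x)$. Assume $|H_{ij}(x)|\le L_{ij}$ for all $x$ and all $i,j$, and set $L_i=L_{ii}$ (the Lipschitz constant of $\nabla_i g$ with respect to coordinate $x_i$), with $L_{ij}\le\sqrt{L_i}\sqrt{L_j}$. $P_{\max}=\max_kP_k$, $P_{\min}=\min_kP_k$. For $\xi=(\xi_2,\dots,\xi_K)$ with $\xi_k\in\mathbb{R}^K$, $H(\xi)$ is the strictly lower triangular $K\times K$ matrix whose $(k,j)$ entry is $H_{kj}(\xi_k)$ if $j<k$ and $0$ if $j\ge k$ (so each row is evaluated at its own point). $\|H(\xi)\|$ is the spectral norm; vector norms are Euclidean. Cyclic CGD: from $x^{(0)}\in\mathbb{R}^K$, given $x^{(r)}$ set $w_1^{(r)}=x^{(r)}$, and for $k=1,\dots,K$ set $w_{k+1}^{(r)}=w_k^{(r)}-\frac1{P_k}\nabla_kg(w_k^{(r)})e_k$,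 where $e_k$ is the $k$-th unit vector; then $x^{(r+1)}=w_{K+1}^{(r)}$. $X^*$ is the set of minimizers of $g$, assumed nonempty, and $R_0=\max_{x\in\mathbb{R}^K}\max_{x^*\in X^*}\{\|x-x^*\| : g(x)\le g(x^{(0)})\}$, assumed finite. *)

(* Defs.v *)
From HB Require Import structures.
From mathcomp Require Import all_boot all_order all_algebra.
From mathcomp Require Import all_classical all_reals all_analysis.

Set Implicit Arguments.
Unset Strict Implicit.
Unset Printing Implicit Defensive.

Import Order.TTheory GRing.Theory Num.Theory.
Import numFieldNormedType.Exports.

Local Open Scope classical_set_scope.
Local Open Scope ring_scope.

(* Points of R^K are row vectors. The library norm on matrices is the sup
   norm, so the Euclidean norm is introduced separately; it induces the same
   topology, hence the library's [derive] and [differentiable] apply as is. *)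
Definition enorm (R : realType) (K : nat) (v : 'rV[R]_K) : R :=
  Num.sqrt (\sum_i v 0 i ^+ 2).

(* The operator norm induced by the Euclidean norm; [v *m A^T] is the
   transpose of [A v]. The set is nonempty and bounded. *)
Definition spectral_norm (R : realType) (K : nat) (A : 'M[R]_K) : R :=
  sup [set enorm (v *m A^T) | v in [set v : 'rV[R]_K | enorm v <= 1]].

Definition unitv (R : realType) (K : nat) (i : 'I_K) : 'rV[R]_K :=
  delta_mx 0 i.

Definition partial (R : realType) (K : nat) (g : 'rV[R]_K -> R) (i : 'I_K)
    (x : 'rV[R]_K) : R :=
  'D_(unitv R i) g x.

Definition gradient (R : realType) (K : nat) (g : 'rV[R]_K -> R)
    (x : 'rV[R]_K) : 'rV[R]_K :=
  \row_i partial g i x.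

(* d^2 g / (dx_i dx_j): first along x_j, then along x_i. *)
Definition hess (R : realType) (K : nat) (g : 'rV[R]_K -> R) (i j : 'I_K)
    (x : 'rV[R]_K) : R :=
  partial (partial g j) i x.

Definition twice_differentiable (R : realType) (K : nat)
    (g : 'rV[R]_K -> R) : Prop :=
  (forall x, differentiable g x) /\ (forall x, differentiable (gradient g) x).

Definition lipschitz_gradient (R : realType) (K : nat)
    (g : 'rV[R]_K -> R) : Prop :=
  exists M : R, forall x y,
    enorm (gradient g x - gradient g y) <= M * enorm (x - y).

(* Row k is evaluated at xi k. The row of index 0 vanishes, so xi at the
   first index plays no role. *)
Definition lower_hess (R : realType) (K : nat) (g : 'rV[R]_K -> R)
    (xi : 'I_K -> 'rV[R]_K) : 'M[R]_K :=
  \matrix_(k, j) (if (j < k)%N then hess g k j (xi k) else 0).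

Definition coord_step (R : realType) (K : nat) (g : 'rV[R]_K -> R)
    (P : 'I_K -> R) (w : 'rV[R]_K) (k : 'I_K) : 'rV[R]_K :=
  w - ((P k)^-1 * partial g k w) *: unitv R k.

(* [enum 'I_K] lists the indices in increasing order. *)
Definition cgd_sweep (R : realType) (K : nat) (g : 'rV[R]_K -> R)
    (P : 'I_K -> R) (x : 'rV[R]_K) : 'rV[R]_K :=
  foldl (coord_step g P) x (enum 'I_K).

Definition cyclic_cgd (R : realType) (K : nat) (g : 'rV[R]_K -> R)
    (P : 'I_K -> R) (x : nat -> 'rV[R]_K) : Prop :=
  forall r, x r.+1 = cgd_sweep g P (x r).

Definition minimizers (R : realType) (K : nat) (g : 'rV[R]_K -> R) :
    set 'rV[R]_K :=
  [set x | forall y, g x <= g y].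

Definition level_distances (R : realType) (K : nat) (g : 'rV[R]_K -> R)
    (x0 : 'rV[R]_K) : set R :=
  [set d | exists x xs,
     [/\ g x <= g x0, minimizers g xs & d = enorm (x - xs)]].

(* Only meaningful when [level_distances g x0] is nonempty and bounded above;
   for continuous g the supremum is then attained, by compactness. *)
Definition level_radius (R : realType) (K : nat) (g : 'rV[R]_K -> R)
    (x0 : 'rV[R]_K) : R :=
  sup (level_distances g x0).

Definition vmax (R : realType) (n : nat) (P : 'I_n.+1 -> R) : R :=
  \big[Order.max/P ord0]_k P k.

Definition vmin (R : realType) (n : nat) (P : 'I_n.+1 -> R) : R :=
  \big[Order.min/P ord0]_k P k.

(* Main.v *)
(* Let [w_1 = x, ..., w_{K+1} = y] be the points of one sweep, with
   [G_k = partial_k g(w_k)], [G'_k = partial_k g(w_{k+1})], [d_k = G_k / P_k], and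
   [M = P_max + beta^2 / P_min]. Convexity and smoothness along each coordinate
   give the two-sided gain [g(x) - g(y) >= 1/2 sum_k (G_k^2 + G'_k^2) / P_k], while
   [grad g(y)] differs from [G'] by [- H(xi)^T d], so Cauchy-Schwarz gives
   [|grad g(y)|^2 <= 2 M (g(x) - g(y))]. Estimating the gradient at the end of the
   sweep, not at its start, saves a factor 2. The same sweep argument shows
   [g(x* + v) <= g(x* ) + M |v|^2], whence, with [D = R_0],
   [g(y) - g(x* ) <= D |grad g(y)| - |grad g(y)|^2 / (4 M)]. For
   [delta = (g - g(x* )) / (2 M D^2)] the two estimates combine into
   [1 / delta(y) >= 1 + 1 / delta(x)]. *)
Require Import Defs.
From HB Require Import structures.
From mathcomp Require Import all_boot all_order all_algebra.
From mathcomp Require Import all_classical all_reals all_analysis.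
From mathcomp Require Import ring lra.

Set Implicit Arguments.
Unset Strict Implicit.
Unset Printing Implicit Defensive.

Import Order.TTheory GRing.Theory Num.Theory.
Import numFieldNormedType.Exports.

Local Open Scope classical_set_scope.
Local Open Scope ring_scope.

(** * Calculus along a line: mean value, descent and tangent inequalities *)

Lemma is_derive_line (R : realType) (V : normedModType R) (f : V -> R)
    (x v : V) (t : R) :
  derivable f (x + t *: v) v ->
  is_derive t 1 (fun s : R => f (x + s *: v)) ('D_v f (x + t *: v)).
Proof.
move=> df.
have E : (fun h : R => h^-1 *: (((fun s => f (x + s *: v)) \o shift t) (h *: 1)
      - f (x + t *: v)))
    = (fun h : R => h^-1 *: ((f \o shift (x + t *: v)) (h *: v)
      - f (x + t *: v))).
  apply/funext => h /=; congr (_ *: (f _ - _)).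
  by rewrite scaler1 scalerDl addrCA.
split; first by rewrite /derivable E.
by rewrite /derive E.
Qed.

(** The step [t] may have either sign, and [s] is not located, because the mean value point is only
    ever fed to bounds that hold everywhere. *)
Lemma MVT_line (R : realType) (V : normedModType R) (f : V -> R) (v : V) :
  (forall y, derivable f y v) -> forall (x : V) (t : R),
  exists s : R, f (x + t *: v) - f x = t * 'D_v f (x + s *: v).
Proof.
move=> df x t.
have dl s := is_derive_line (df (x + s *: v)).
have cl : continuous (fun s : R => f (x + s *: v)).
  move=> s; apply: differentiable_continuous; apply/derivable1_diffP.
  exact: ex_derive.
have [t0|/ltW t0] := leP 0 t.
  have [s _] := MVT_segment t0 (fun s _ => dl s)
    (continuous_subspaceT cl).
  by rewrite scale0r addr0 subr0 mulrC => ->; exists s.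
have [s _] := MVT_segment t0 (fun s _ => dl s)
  (continuous_subspaceT cl).
rewrite scale0r addr0 sub0r => E; exists s.
by rewrite -opprB E mulrN opprK mulrC.
Qed.

(* [f(x + t v) - f(x) - t D_v f(x) - P t^2 / 2], as a function of [t], decreases
   away from [t = 0]. *)
Lemma descent_line (R : realType) (V : normedModType R) (f : V -> R) (x v : V)
    (P : R) :
  (forall y, derivable f y v) -> (forall y, derivable ('D_v f) y v) ->
  (forall y, `|'D_v ('D_v f) y| <= P) ->
  forall t : R, f (x + t *: v) <= f x + t * 'D_v f x + P / 2 * t ^+ 2.
Proof.
move=> df ddf ddfP t.
pose psi : R -> R := (fun s : R => f (x + s *: v)) - (cst ('D_v f x) * id)
  - (cst (P / 2) * id ^+ 2).
have dpsi (s : R) :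
    is_derive s 1 psi ('D_v f (x + s *: v) - 'D_v f x - P * s).
  have := is_derive_line (df (x + s *: v)) => ?.
  apply: is_derive_eq.
  rewrite !(scaler0, addr0, scaler1, expr1) /cst /=.
  rewrite /GRing.scale /=; lra.
have slope (s : R) : `|'D_v f (x + s *: v) - 'D_v f x| <= P * `|s|.
  have [u ->] := MVT_line ddf x s.
  by rewrite normrM mulrC ler_wpM2r.
have cpsi : continuous psi.
  move=> s; apply: differentiable_continuous; apply/derivable1_diffP.
  exact: ex_derive.
have psiE (s : R) : psi s = f (x + s *: v) - 'D_v f x * s - P / 2 * s ^+ 2 by [].
have dpsi1 (s : R) : (psi^`())%classic s = 'D_v f (x + s *: v) - 'D_v f x - P * s.
  by rewrite derive1E derive_val.
suff : psi t <= psi 0.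
  by rewrite !psiE scale0r addr0 mulr0 expr0n /= mulr0 !subr0; lra.
have [t0|/ltW t0] := leP 0 t.
- apply: (@ler0_derive1_nincry _ psi 0) => // [s|].
  + rewrite in_itv /= andbT => s0; rewrite dpsi1.
    by have := slope s; rewrite (gtr0_norm s0) ler_norml => /andP[_]; lra.
  + exact: continuous_subspaceT.
- apply: (@ger0_derive1_ndecrNy _ psi 0) => // [s|].
  + rewrite in_itv /= => s0; rewrite dpsi1.
    by have := slope s; rewrite (ltr0_norm s0) ler_norml => /andP[]; lra.
  + exact: continuous_subspaceT.
Qed.

(** By convexity, every difference quotient with step in (0, 1] along the chord is at most
    [f y - f x]; the bound passes to the right limit. *)
Lemma convex_ge_tangent (R : realType) (V : normedModType R) (f : V -> R)
    (x y : V) :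
  convex_function [set: V] f -> derivable f x (y - x) ->
  f x + 'D_(y - x) f x <= f y.
Proof.
move=> fc df; rewrite -lerBrDl.
have dr : h^-1 *: ((f \o shift x) (h *: (y - x)) - f x) @[h --> 0^'+]
    --> 'D_(y - x) f x by exact: cvg_dnbhs_at_right df.
rewrite -(cvg_lim _ dr)//; apply: limr_le; first by apply/cvg_ex; eexists; exact: dr.
near=> h.
have h0 : 0 < h by near: h; exact: nbhs_right_gt.
have h1 : h <= 1 by near: h; apply: nbhs_right_le.
have h01 : Itv.spec (@Itv.num_sem _) (Itv.Real `[0%Z, 1%Z]) h.
  by rewrite /Itv.spec /= /Itv.num_sem /= in_itv /= (ltW h0) h1 ger0_real ?ltW.
have yD : y \in [set: V] by rewrite inE.
have xD : x \in [set: V] by rewrite inE.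
have H : f (h *: y + (1 - h) *: x) <= h * f y + (1 - h) * f x.
  exact: (fc (Itv.mk h01) y x yD xD).
change (h^-1 * (f (h *: (y - x) + x) - f x) <= f y - f x).
rewrite ler_pdivrMl//.
have -> : h *: (y - x) + x = h *: y + (1 - h) *: x.
  by rewrite scalerBl scale1r scalerBr addrAC addrA.
lra.
Unshelve. all: by end_near.
Qed.

(** * Euclidean norm and spectral norm *)

Lemma enorm_ge0 (R : realType) (n : nat) (v : 'rV[R]_n) : 0 <= enorm v.
Proof. exact: sqrtr_ge0. Qed.

Lemma sqr_enorm (R : realType) (n : nat) (v : 'rV[R]_n) :
  enorm v ^+ 2 = \sum_i v 0 i ^+ 2.
Proof. by rewrite sqr_sqrtr// sumr_ge0// => i _; exact: sqr_ge0. Qed.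

Lemma enorm0_eq0 (R : realType) (n : nat) (v : 'rV[R]_n) :
  enorm v = 0 -> v = 0.
Proof.
move=> v0; have /eqP := sqr_enorm v; rewrite v0 expr0n/= eq_sym.
rewrite psumr_eq0 => [/allP h|i _]; last exact: sqr_ge0.
apply/rowP => i; rewrite mxE; apply/eqP.
by have := h i (mem_index_enum i); rewrite sqrf_eq0.
Qed.

Lemma enormZ (R : realType) (n : nat) (c : R) (v : 'rV[R]_n) :
  enorm (c *: v) = `|c| * enorm v.
Proof.
rewrite /enorm -sqrtr_sqr -sqrtrM ?sqr_ge0// mulr_sumr.
by congr Num.sqrt; apply: eq_bigr => i _; rewrite mxE exprMn.
Qed.

Lemma enormN (R : realType) (n : nat) (v : 'rV[R]_n) : enorm (- v) = enorm v.
Proof. by rewrite -scaleN1r enormZ normrN normr1 mul1r. Qed.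

Lemma cauchy_schwarz (R : realType) (n : nat) (u v : 'rV[R]_n) :
  \sum_i u 0 i * v 0 i <= enorm u * enorm v.
Proof.
have [u0|u0] := eqVneq (enorm u) 0.
  rewrite (enorm0_eq0 u0) big1 ?mulr_ge0 ?enorm_ge0// => i _.
  by rewrite mxE mul0r.
have [v0|v0] := eqVneq (enorm v) 0.
  rewrite (enorm0_eq0 v0) big1 ?mulr_ge0 ?enorm_ge0// => i _.
  by rewrite mxE mulr0.
set a := enorm u in u0 *; set b := enorm v in v0 *.
have ab_gt0 : 0 < a * b by rewrite mulr_gt0// lt0r ?u0 ?v0 enorm_ge0.
have : 0 <= \sum_i (b * u 0 i - a * v 0 i) ^+ 2.
  by apply: sumr_ge0 => i _; exact: sqr_ge0.
have -> : \sum_i (b * u 0 i - a * v 0 i) ^+ 2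
    = b ^+ 2 * (\sum_i u 0 i ^+ 2) + a ^+ 2 * (\sum_i v 0 i ^+ 2)
      - 2 * (a * b) * \sum_i u 0 i * v 0 i.
  rewrite !mulr_sumr -big_split -sumrB /=.
  by apply: eq_bigr => i _; ring.
rewrite -!sqr_enorm -/a -/b.
have -> : b ^+ 2 * a ^+ 2 + a ^+ 2 * b ^+ 2
    - 2 * (a * b) * (\sum_i u 0 i * v 0 i)
    = 2 * (a * b) * (a * b - \sum_i u 0 i * v 0 i) by ring.
by rewrite pmulr_rge0 ?subr_ge0// mulr_gt0.
Qed.

Lemma cauchy_schwarz_abs (R : realType) (n : nat) (u v : 'rV[R]_n) :
  `|\sum_i u 0 i * v 0 i| <= enorm u * enorm v.
Proof.
rewrite ler_norml cauchy_schwarz andbT lerNl -sumrN -(enormN u).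
have -> : \sum_i - (u 0 i * v 0 i) = \sum_i (- u) 0 i * v 0 i.
  by apply: eq_bigr => i _; rewrite mxE mulNr.
exact: cauchy_schwarz.
Qed.

(** Serves to show that the set defining [spectral_norm] is bounded above, so that its [sup] is a
    genuine upper bound. *)
Lemma enorm_mulmx_le_frobenius (R : realType) (n : nat) (A : 'M[R]_n)
    (v : 'rV[R]_n) :
  enorm (v *m A^T) <= enorm v * Num.sqrt (\sum_i enorm (row i A) ^+ 2).
Proof.
have F0 : 0 <= \sum_i enorm (row i A) ^+ 2.
  by apply: sumr_ge0 => i _; exact: sqr_ge0.
rewrite -(@ler_pXn2r _ 2)// ?nnegrE ?mulr_ge0 ?enorm_ge0 ?sqrtr_ge0//.
rewrite exprMn (sqr_sqrtr F0) sqr_enorm mulr_sumr ler_sum// => i _.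
have -> : (v *m A^T) 0 i = \sum_j v 0 j * row i A 0 j.
  by rewrite mxE; apply: eq_bigr => j _; rewrite !mxE.
rewrite -exprMn -[leLHS]real_normK ?num_real// lerXn2r//.
- by rewrite nnegrE mulr_ge0// enorm_ge0.
- exact: cauchy_schwarz_abs.
Qed.

Lemma enorm_mulmx_le_spectral (R : realType) (n : nat) (A : 'M[R]_n)
    (v : 'rV[R]_n) :
  enorm (v *m A^T) <= spectral_norm A * enorm v.
Proof.
have [v0|v0] := eqVneq (enorm v) 0.
  by rewrite v0 mulr0 (le_trans (enorm_mulmx_le_frobenius A v))// v0 mul0r.
have v_gt0 : 0 < enorm v by rewrite lt0r v0 enorm_ge0.
rewrite -ler_pdivrMr//; apply: ub_le_sup; last first.
  exists ((enorm v)^-1 *: v) => /=.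
    by rewrite enormZ gtr0_norm ?invr_gt0// mulVf.
  by rewrite -scalemxAl enormZ gtr0_norm ?invr_gt0// mulrC.
exists (Num.sqrt (\sum_i enorm (row i A) ^+ 2)) => _ [u /= u1 <-].
by rewrite (le_trans (enorm_mulmx_le_frobenius A u))// ler_piMl ?sqrtr_ge0.
Qed.

(** * Coordinate steps and gradient gaps along a sweep *)

Lemma derivable_partial (R : realType) (n : nat) (g : 'rV[R]_n -> R)
    (k : 'I_n) (y v : 'rV[R]_n) :
  differentiable (gradient g) y -> derivable (partial g k) y v.
Proof.
move=> dg; have /derivable_mxP/(_ 0 k) : derivable (gradient g) y v.
  exact: diff_derivable.
suff -> : (fun x => gradient g x 0 k) = partial g k by [].
by apply/funext => x; rewrite mxE.
Qed.

Lemma derive_gradient (R : realType) (n : nat) (g : 'rV[R]_n -> R)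
    (x v : 'rV[R]_n) :
  differentiable g x -> 'D_v g x = \sum_i v 0 i * partial g i x.
Proof.
move=> dg; rewrite deriveE// {1}(row_sum_delta v) linear_sum.
by apply: eq_bigr => i _; rewrite linearZ /partial /unitv deriveE.
Qed.

Lemma convex_ge_gradient (R : realType) (n : nat) (g : 'rV[R]_n -> R)
    (x y : 'rV[R]_n) :
  convex_function [set: 'rV[R]_n] g -> differentiable g x ->
  g x + \sum_i (y - x) 0 i * partial g i x <= g y.
Proof.
move=> gc dg; rewrite -derive_gradient//.
by apply: convex_ge_tangent => //; exact: diff_derivable.
Qed.

Lemma coord_descent (R : realType) (n : nat) (g : 'rV[R]_n -> R) (P : R)
    (k : 'I_n) :
  twice_differentiable g -> (forall y, `|hess g k k y| <= P) ->
  forall (x : 'rV[R]_n) (t : R),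
  g (x + t *: unitv R k) <= g x + t * partial g k x + P / 2 * t ^+ 2.
Proof.
move=> [dg ddg] hP x t; apply: descent_line => [y|y|//].
  exact: diff_derivable.
exact: derivable_partial.
Qed.

Lemma gradient_step_descent (R : realType) (n : nat) (g : 'rV[R]_n -> R) (P : R)
    (k : 'I_n) (w : 'rV[R]_n) (w' := w - (P^-1 * partial g k w) *: unitv R k) :
  convex_function [set: 'rV[R]_n] g -> twice_differentiable g ->
  0 < P -> (forall y, `|hess g k k y| <= P) ->
  (partial g k w ^+ 2 / P + partial g k w' ^+ 2 / P) / 2 <= g w - g w'.
Proof.
move=> gc g2 P0 hP; set G := partial g k w in w' *; set G' := partial g k w'.
(* With [p] at [w' + t e_k], the tangent at [w'] and the descent bound from [w] give a gain of at
   least [G^2 / (2 P) + t G' - P t^2 / 2]; the best choice is [t = G' / P]. *)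
pose p := w - ((G - G') / P) *: unitv R k.
have pw' : p - w' = (G' / P) *: unitv R k.
  rewrite /p /w' opprB addrC addrA subrK -scalerBl.
  congr (_ *: _); ring.
have lo : g w' + G' / P * G' <= g p.
  have := convex_ge_gradient p gc (g2.1 w').
  rewrite pw' (bigD1 k)//= big1 ?addr0; last first.
    by move=> i ik; rewrite !mxE eqxx (negbTE ik) mulr0 mul0r.
  by rewrite !mxE !eqxx mulr1.
have up := coord_descent g2 hP w (- ((G - G') / P)).
rewrite scaleNr -/p -/G in up.
have := le_trans lo up.
have -> : (G ^+ 2 / P + G' ^+ 2 / P) / 2 = G' / P * G'
   + ((G - G') / P) * G - P / 2 * (- ((G - G') / P)) ^+ 2.
  by field; rewrite gt_eqF.
lra.
Qed.

(* The gradient differences are telescoped along the sweep and the double sum is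
   exchanged: all increments along the [j]-th step are combined before the mean
   value theorem is applied, so they share the single point [xi j], and they are
   derivatives along [e_j], i.e. they form row [j] of [lower_hess]. Hence
   neither symmetry nor continuity of the Hessian is needed. *)
Lemma sweep_gradient_gap (R : realType) (n : nat) (g : 'rV[R]_n -> R)
    (w : nat -> 'rV[R]_n) (d z : 'rV[R]_n) :
  (forall y, differentiable (gradient g) y) ->
  (forall k : 'I_n, w k.+1 = w k - d 0 k *: unitv R k) ->
  exists xi, \sum_k z 0 k * (partial g k (w k.+1) - partial g k (w n))
    = \sum_j d 0 j * (z *m (lower_hess g xi)^T) 0 j.
Proof.
move=> ddg wS.
have xiP (j : 'I_n) : exists y,
    \sum_(k < n | (k < j)%N) z 0 k * (partial g k (w j) - partial g k (w j.+1))
    = d 0 j * \sum_(k < n | (k < j)%N) z 0 k * hess g j k y.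
  (* The cutoff [k < j] is put into the coefficients, so that a single function [f] carries all
     increments of step [j]. *)
  pose c (k : 'I_n) := if (k < j)%N then z 0 k else 0.
  pose f := \sum_(k < n) (c k *: partial g k).
  have df y : derivable f y (unitv R j).
    by apply: derivable_sum => k; apply/derivableZ/derivable_partial.
  have Df y : 'D_(unitv R j) f y = \sum_(k < n | (k < j)%N) z 0 k * hess g j k y.
    rewrite derive_sum => [|k]; last exact/derivableZ/derivable_partial.
    rewrite [RHS]big_mkcond; apply: eq_bigr => k _.
    rewrite deriveZ; last exact/derivable_partial.
    by rewrite /c; case: ifP => // _; rewrite scale0r.
  have fE y : f y = \sum_(k < n | (k < j)%N) z 0 k * partial g k y.
    rewrite /f fct_sumE [RHS]big_mkcond; apply: eq_bigr => k _.
    by rewrite /c /=; case: ifP => // _; rewrite scale0r.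
  have [s fs] := MVT_line df (w j) (- d 0 j).
  exists (w j + s *: unitv R j); rewrite -Df.
  apply: oppr_inj; rewrite -mulNr -fs scaleNr -wS !fE -sumrB -sumrN.
  by apply: eq_bigr => k _; ring.
have [xi xiE] := choice xiP; exists xi.
transitivity (\sum_(k < n) \sum_(j < n | (k < j)%N)
    z 0 k * (partial g k (w j) - partial g k (w j.+1))).
  (* From [w k.+1] to [w n] only the steps [j] with [k < j < n] are taken: this is the strict
     triangle of [lower_hess]. *)
  apply: eq_bigr => k _; rewrite -mulr_sumr; congr (_ * _).
  rewrite -(big_geq_mkord _ _ xpredT (fun j =>
    partial g k (w j) - partial g k (w j.+1))).
  rewrite (@telescope_sumr_eq _ _ _ (fun j => - partial g k (w j)))//.
    by rewrite opprK addrC.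
  by move=> j _; rewrite opprK addrC.
rewrite (exchange_big_dep xpredT)//=; apply: eq_bigr => j _.
rewrite xiE mxE; congr (_ * _).
rewrite big_mkcond; apply: eq_bigr => k _; rewrite !mxE.
by case: ifP => // _; rewrite mulr0.
Qed.

Lemma sweep_gradient_gap_le (R : realType) (n : nat) (g : 'rV[R]_n -> R)
    (w : nat -> 'rV[R]_n) (d z : 'rV[R]_n) (beta : R) :
  (forall y, differentiable (gradient g) y) ->
  (forall xi, spectral_norm (lower_hess g xi) <= beta) ->
  (forall k : 'I_n, w k.+1 = w k - d 0 k *: unitv R k) ->
  `|\sum_k z 0 k * (partial g k (w k.+1) - partial g k (w n))|
    <= beta * enorm d * enorm z.
Proof.
move=> ddg hb wS; have [xi ->] := sweep_gradient_gap z ddg wS.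
rewrite (le_trans (cauchy_schwarz_abs _ _))// mulrAC mulrC.
apply: ler_wpM2r; first exact: enorm_ge0.
rewrite (le_trans (enorm_mulmx_le_spectral _ _))//.
by apply: ler_wpM2r; [exact: enorm_ge0|exact: hb].
Qed.

(** * Scalar inequalities *)

Lemma sqr_sum_le_weighted (R : realFieldType) (beta M m a b p q : R) :
  0 < M -> 0 < m -> p ^+ 2 <= M * a -> q ^+ 2 <= b / m ->
  (p + beta * q) ^+ 2 <= (M + beta ^+ 2 / m) * (a + b).
Proof.
move=> M0 m0 pa qb.
have mV : 0 < m^-1 by rewrite invr_gt0.
have MV : 0 < M^-1 by rewrite invr_gt0.
have b2 : beta ^+ 2 * q ^+ 2 <= beta ^+ 2 * (b / m).
  by rewrite ler_wpM2l ?sqr_ge0.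
have Mb : M * m * q ^+ 2 <= M * b.
  by rewrite -mulrA ler_pM2l// mulrC -ler_pdivlMr.
have ma : beta ^+ 2 / m * (M^-1 * p ^+ 2) <= beta ^+ 2 / m * a.
  apply: ler_wpM2l; first by rewrite mulr_ge0 ?sqr_ge0// ltW.
  by rewrite ler_pdivrMl.
(* This square is the defect in the weighted Cauchy-Schwarz inequality [(p + beta q)^2 <= (M +
   beta^2 / m) (p^2 / M + m q^2)]. *)
have AMGM : 0 <= M * m * (q - beta * p / (M * m)) ^+ 2.
  by rewrite mulr_ge0 ?sqr_ge0// mulr_ge0// ltW.
have E : M * m * (q - beta * p / (M * m)) ^+ 2
   = M * m * q ^+ 2 - 2 * (beta * p * q) + beta ^+ 2 / m * (M^-1 * p ^+ 2).
  by field; rewrite !gt_eqF.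
rewrite E in AMGM; lra.
Qed.

Lemma rate_step (R : realFieldType) (M D s u v r : R) :
  0 < M -> 0 <= D -> 0 <= s -> 0 <= u -> 0 <= v -> 0 <= r ->
  v <= D * s - s ^+ 2 / (4 * M) -> s ^+ 2 <= 2 * M * (u - v) ->
  r * u <= 2 * M * D ^+ 2 -> (r + 1) * v <= 2 * M * D ^+ 2.
Proof.
move=> M0 D0 s0 u0 v0 r0; set q := _ - _ => vq suv ruA.
set A := 2 * M * D ^+ 2 in ruA *.
have MV : 0 < M^-1 by rewrite invr_gt0.
have [D00|Dn0] := eqVneq D 0.
  have : q <= 0.
    by rewrite /q D00 mul0r sub0r oppr_le0 divr_ge0 ?sqr_ge0 ?mulr_ge0// ltW.
  have A0 : A = 0 by rewrite /A D00 expr0n mulr0.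
  move=> q0; have -> : v = 0 by lra.
  by rewrite mulr0 A0.
have Dpos : 0 < D by rewrite lt0r Dn0.
have A_gt0 : 0 < A by rewrite /A !mulr_gt0 ?exprn_gt0.
have Aq : q <= A.
  have : 0 <= M * (D - s / (2 * M)) ^+ 2 + M * D ^+ 2.
    by rewrite addr_ge0// mulr_ge0 ?sqr_ge0// ltW.
  have -> : M * (D - s / (2 * M)) ^+ 2 + M * D ^+ 2 = A - q.
    by rewrite /A /q; field; rewrite gt_eqF.
  by rewrite subr_ge0.
have Av : v <= A by exact: le_trans vq Aq.
(* The weight [1 / (4 M)] in [q] makes the terms in [s^2] and [s^3] cancel; only a fourth power
   remains. *)
have qs : q ^+ 2 <= s ^+ 2 / (2 * M) * (A - q).
  rewrite -subr_ge0.
  have -> : s ^+ 2 / (2 * M) * (A - q) - q ^+ 2 = (s ^+ 2 / M) ^+ 2 / 16.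
    by rewrite /A /q; field; rewrite gt_eqF.
  by rewrite divr_ge0 ?sqr_ge0.
have sM : s ^+ 2 / (2 * M) <= u - v.
  by rewrite ler_pdivrMr ?mulr_gt0// mulrC.
(* A division-free form of [1 / v >= 1 / A + 1 / u], valid also when [u] or [v] vanishes. It follows
   from [v^2 <= (u - v) (A - v)], where [v^2] cancels. *)
have key : A * v <= u * (A - v).
  have v2 : v ^+ 2 <= q ^+ 2 by rewrite lerXn2r ?nnegrE// (le_trans v0).
  have h1 : s ^+ 2 / (2 * M) * (A - q) <= s ^+ 2 / (2 * M) * (A - v).
    by rewrite ler_wpM2l ?divr_ge0 ?sqr_ge0 ?mulr_ge0 ?(ltW M0)// lerD2l lerN2.
  have h2 : s ^+ 2 / (2 * M) * (A - v) <= (u - v) * (A - v).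
    by rewrite ler_wpM2r// subr_ge0.
  lra.
have : r * (A * v) <= r * (u * (A - v)) by rewrite ler_wpM2l.
have : r * u * (A - v) <= A * (A - v) by rewrite ler_wpM2r// subr_ge0.
move=> h1 h2; rewrite -(ler_pM2l A_gt0); lra.
Qed.

(** * Extreme stepsizes and growth near a minimizer *)

Lemma le_vmax (R : realType) (n : nat) (P : 'I_n.+1 -> R) (k : 'I_n.+1) :
  P k <= vmax P.
Proof. exact: le_bigmax. Qed.

Lemma vmin_le (R : realType) (n : nat) (P : 'I_n.+1 -> R) (k : 'I_n.+1) :
  vmin P <= P k.
Proof. exact: bigmin_le. Qed.

Lemma vmin_gt0 (R : realType) (n : nat) (P : 'I_n.+1 -> R) :
  (forall k, 0 < P k) -> 0 < vmin P.
Proof. by move=> P0; apply: lt_bigmin. Qed.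

(** Otherwise a coordinate step of length [- G / P] would lower [g] by at least [G^2 / (2 P)]. *)
Lemma minimizer_partial (R : realType) (n : nat) (g : 'rV[R]_n -> R) (P : R)
    (k : 'I_n) (xs : 'rV[R]_n) :
  twice_differentiable g -> 0 < P -> (forall y, `|hess g k k y| <= P) ->
  minimizers g xs -> partial g k xs = 0.
Proof.
move=> g2 P0 hP xsmin; set G := partial g k xs.
have := le_trans (xsmin _) (coord_descent g2 hP xs (- (G / P))).
rewrite -/G -addrA lerDl.
have -> : - (G / P) * G + P / 2 * (- (G / P)) ^+ 2 = - (G ^+ 2 / (2 * P)).
  by field; rewrite gt_eqF.
rewrite oppr_ge0 pmulr_lle0 ?invr_gt0 ?mulr_gt0// => G2.
by apply/eqP; rewrite -sqrf_eq0 eq_le G2 sqr_ge0.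
Qed.

Lemma telescope_sum_ord (V : zmodType) (n : nat) (f : nat -> V) :
  \sum_(k < n) (f k - f k.+1) = f 0%N - f n.
Proof.
rewrite -(big_mkord xpredT (fun k => f k - f k.+1)).
rewrite (@telescope_sumr_eq _ _ _ (fun k => - f k))//.
  by rewrite opprK addrC.
by move=> k _; rewrite opprK addrC.
Qed.

(* The chord from [xs + v] to [xs] is replaced by a coordinate sweep, which has
   the shape required by [sweep_gradient_gap]. *)
Lemma minimizer_quadratic_bound (R : realType) (n : nat)
    (g : 'rV[R]_n.+1 -> R) (P : 'I_n.+1 -> R) (beta : R) (xs v : 'rV[R]_n.+1) :
  twice_differentiable g -> (forall k, 0 < P k) ->
  (forall k y, `|hess g k k y| <= P k) ->
  (forall xi, spectral_norm (lower_hess g xi) <= beta) ->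
  minimizers g xs ->
  g (xs + v) <= g xs + (vmax P + beta ^+ 2 / vmin P) * enorm v ^+ 2.
Proof.
move=> g2 P0 hP hb xsmin.
(* The path runs from [xs + v] to [xs], removing one coordinate of [v] at a time, so the gradient at
   its end point is zero. *)
pose w m := xs + \sum_(j < n.+1 | (m <= j)%N) v 0 j *: unitv R j.
have wE (k : 'I_n.+1) : w k = w k.+1 + v 0 k *: unitv R k.
  rewrite /w (bigD1 k)//= -addrA; congr (xs + _).
  rewrite addrC; congr (_ + _); apply: eq_bigl => j.
  by rewrite ltn_neqAle andbC (eq_sym (nat_of_ord k)).
have w0 : w 0%N = xs + v by rewrite /w -row_sum_delta.
have wn : w n.+1 = xs.
  by rewrite /w big_pred0 ?addr0// => j; rewrite leqNgt ltn_ord.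
have wS (k : 'I_n.+1) : w k.+1 = w k - v 0 k *: unitv R k by rewrite wE addrK.
have := sweep_gradient_gap_le v g2.2 hb wS.
rewrite wn => /(le_trans (ler_norm _)).
under eq_bigr do rewrite (minimizer_partial g2 (P0 _) (hP _) xsmin) subr0.
move=> gap.
have diag : \sum_k P k / 2 * v 0 k ^+ 2 <= vmax P / 2 * enorm v ^+ 2.
  rewrite sqr_enorm mulr_sumr ler_sum// => k _.
  by rewrite ler_wpM2r ?sqr_ge0// ler_pM2r ?invr_gt0// le_vmax.
(* Each step is read backwards, from [w k.+1] to [w k], so that the partial derivatives sit at
   [w k.+1], as in [gap]. *)
have desc : g (w 0%N) - g (w n.+1) <= \sum_k v 0 k * partial g k (w k.+1)
    + \sum_k P k / 2 * v 0 k ^+ 2.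
  rewrite -(telescope_sum_ord _ (g \o w)) -big_split ler_sum//= => k _.
  rewrite lerBlDl addrA [in leLHS]wE; exact: coord_descent.
have m0 := vmin_gt0 P0.
have mM : vmin P <= vmax P := le_trans (vmin_le P ord0) (le_vmax P ord0).
(* The gap contributes [beta] and the diagonal [vmax P / 2]. Completing the square bounds [beta] by
   [beta^2 / vmin P + vmin P / 4]. *)
have beta_le : beta + vmax P / 2 <= vmax P + beta ^+ 2 / vmin P.
  have : 0 <= (beta - vmin P / 2) ^+ 2 / vmin P.
    by rewrite divr_ge0 ?sqr_ge0// ltW.
  have -> : (beta - vmin P / 2) ^+ 2 / vmin P
      = beta ^+ 2 / vmin P - beta + vmin P / 4 by field; rewrite gt_eqF.
  lra.
have := ler_wpM2r (sqr_ge0 (enorm v)) beta_le.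
move: desc; rewrite w0 wn; lra.
Qed.

(** * Gradient and optimality gap after one sweep *)

Lemma cgd_sweep_pathP (R : realType) (n : nat) (g : 'rV[R]_n -> R)
    (P : 'I_n -> R) (x : 'rV[R]_n) :
  exists2 w : nat -> 'rV[R]_n, w 0%N = x /\ w n = cgd_sweep g P x &
    forall k : 'I_n, w k.+1 = w k - ((P k)^-1 * partial g k (w k)) *: unitv R k.
Proof.
exists (fun m => foldl (coord_step g P) x (take m (enum 'I_n))).
  by split; rewrite ?take0// take_oversize ?size_enum_ord.
move=> k; rewrite (take_nth k) ?size_enum_ord// foldl_rcons nth_ord_enum.
by [].
Qed.

Lemma sweep_descent (R : realType) (n : nat) (g : 'rV[R]_n.+1 -> R)
    (P : 'I_n.+1 -> R) (beta : R) (x : 'rV[R]_n.+1) (y := cgd_sweep g P x) :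
  convex_function [set: 'rV[R]_n.+1] g -> twice_differentiable g ->
  (forall k, 0 < P k) -> (forall k y, `|hess g k k y| <= P k) ->
  0 <= beta -> (forall xi, spectral_norm (lower_hess g xi) <= beta) ->
  enorm (gradient g y) ^+ 2 <=
    2 * (vmax P + beta ^+ 2 / vmin P) * (g x - g y).
Proof.
move=> gc g2 P0 hP beta0 hb.
have [w [w0 wn] wS] := cgd_sweep_pathP g P x.
have m0 := vmin_gt0 P0.
have M0 : 0 < vmax P := lt_le_trans (P0 ord0) (le_vmax P ord0).
pose G (k : 'I_n.+1) := partial g k (w k).
pose G' : 'rV[R]_n.+1 := \row_(k < n.+1) partial g k (w k.+1).
pose d : 'rV[R]_n.+1 := \row_(k < n.+1) ((P k)^-1 * G k).
have wSd (k : 'I_n.+1) : w k.+1 = w k - d 0 k *: unitv R k by rewrite mxE wS.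
set s := gradient g y.
have gap := sweep_gradient_gap_le s g2.2 hb wSd.
pose a := \sum_k G' 0 k ^+ 2 / P k; pose b := \sum_k G k ^+ 2 / P k.
have desc : (b + a) / 2 <= g x - g y.
  rewrite -w0 -[y]wn -(telescope_sum_ord _ (g \o w)) /a /b -big_split mulr_suml.
  rewrite ler_sum//= => k _; rewrite mxE wS.
  exact: gradient_step_descent.
(* The gap is tested against [z = s], the final gradient itself; one factor [enorm s] is then
   divided out. *)
have sG : enorm s <= enorm G' + beta * enorm d.
  have [s0|s0] := eqVneq (enorm s) 0.
    by rewrite s0 addr_ge0 ?mulr_ge0 ?enorm_ge0.
  have s_gt0 : 0 < enorm s by rewrite lt0r s0 enorm_ge0.
  rewrite -(ler_pM2l s_gt0) -expr2 sqr_enorm.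
  have -> : \sum_i s 0 i ^+ 2 = \sum_k s 0 k * G' 0 k
      - \sum_k s 0 k * (partial g k (w k.+1) - partial g k (w n.+1)).
    rewrite -sumrB; apply: eq_bigr => k _; rewrite wn -/y !mxE; ring.
  have := cauchy_schwarz s G'.
  by move: gap; rewrite ler_norml => /andP[]; lra.
have G'a : enorm G' ^+ 2 <= vmax P * a.
  rewrite sqr_enorm /a mulr_sumr ler_sum// => k _.
  by rewrite mulrCA ler_peMr ?sqr_ge0// ler_pdivlMr// mul1r le_vmax.
have db : enorm d ^+ 2 <= b / vmin P.
  rewrite sqr_enorm /b mulr_suml ler_sum// => k _.
  rewrite mxE mulrC exprMn expr2 exprVn -[leRHS]mulrA ler_wpM2l ?sqr_ge0//.
  rewrite expr2 invfM ler_pM2l ?invr_gt0// lef_pV2 ?posrE//; exact: vmin_le.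
have := sqr_sum_le_weighted beta M0 m0 G'a db.
have s2 : enorm s ^+ 2 <= (enorm G' + beta * enorm d) ^+ 2.
  by rewrite lerXn2r ?nnegrE ?addr_ge0 ?mulr_ge0 ?enorm_ge0.
have MM : 0 <= vmax P + beta ^+ 2 / vmin P.
  by rewrite addr_ge0 ?divr_ge0 ?sqr_ge0// ltW.
have := ler_wpM2l MM desc.
lra.
Qed.

(* Convexity at [x] is tested at [xs + grad g(x) / (2 M)] rather than at [xs]:
   the extra [- |grad g(x)|^2 / (4 M)] is what yields the rate [1 / r] without
   a loss in the constant. *)
Lemma minimizer_gap_le (R : realType) (n : nat) (g : 'rV[R]_n -> R)
    (x xs : 'rV[R]_n) (M : R) (s := enorm (gradient g x)) :
  convex_function [set: 'rV[R]_n] g -> differentiable g x -> 0 < M ->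
  (forall v, g (xs + v) <= g xs + M * enorm v ^+ 2) ->
  g x - g xs <= enorm (x - xs) * s - s ^+ 2 / (4 * M).
Proof.
(* This value of [c] maximizes [c s^2 - M (c s)^2]. *)
move=> gc dg M0 gM; pose c := (2 * M)^-1.
have c0 : 0 < c by rewrite invr_gt0 mulr_gt0.
have lo := convex_ge_gradient (xs + c *: gradient g x) gc dg.
have up := gM (c *: gradient g x).
rewrite enormZ gtr0_norm// -/s in up.
have E : \sum_i (xs + c *: gradient g x - x) 0 i * partial g i x
    = c * s ^+ 2 - \sum_i (x - xs) 0 i * gradient g x 0 i.
  rewrite sqr_enorm mulr_sumr -sumrB; apply: eq_bigr => i _.
  rewrite !mxE; ring.
have cs := cauchy_schwarz (x - xs) (gradient g x).
have cE : c * s ^+ 2 - M * (c * s) ^+ 2 = s ^+ 2 / (4 * M).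
  by rewrite /c; field; rewrite gt_eqF.
rewrite -/s in cs; rewrite E in lo; lra.
Qed.

(** * The convergence rate *)

Unset Implicit Arguments.

Theorem theorem4p1 (R : realType) (n : nat) (g : 'rV[R]_n.+1 -> R)
  (L : 'M[R]_n.+1) (P : 'I_n.+1 -> R) (x : nat -> 'rV[R]_n.+1) (beta : R)
  (g_convex : convex_function [set: 'rV[R]_n.+1] g)
  (g_diff2 : twice_differentiable g)
  (g_lip : lipschitz_gradient g)
  (hess_bound : forall (i j : 'I_n.+1) (y : 'rV[R]_n.+1),
     `|hess g i j y| <= L i j)
  (L_bound : forall i j : 'I_n.+1,
     L i j <= Num.sqrt (L i i) * Num.sqrt (L j j))
  (P_ge_L : forall k : 'I_n.+1, L k k <= P k)
  (P_gt0 : forall k : 'I_n.+1, 0 < P k)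
  (x_cgd : cyclic_cgd g P x)
  (minimizers_neq0 : minimizers g !=set0)
  (R0_finite : has_ubound (level_distances g (x 0%N)))
  (beta_ge0 : 0 <= beta)
  (H_bound : forall xi : 'I_n.+1 -> 'rV[R]_n.+1,
     spectral_norm (lower_hess g xi) <= beta) :
  forall xs : 'rV[R]_n.+1, minimizers g xs ->
  forall r : nat, (1 <= r)%N ->
  g (x r) - g xs <=
    2 * (vmax P + beta ^+ 2 / vmin P) * (level_radius g (x 0%N) ^+ 2 / r%:R).
Proof.
move=> xs xsmin r r1.
set M := vmax P + beta ^+ 2 / vmin P; set D := level_radius g (x 0%N).
have hP k y : `|hess g k k y| <= P k := le_trans (hess_bound k k y) (P_ge_L k).
have M0 : 0 < M.
  apply: ltr_wpDr; first by rewrite divr_ge0 ?sqr_ge0// ltW// vmin_gt0.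
  exact: lt_le_trans (P_gt0 ord0) (le_vmax P ord0).
have desc m : enorm (gradient g (x m.+1)) ^+ 2
    <= 2 * M * (g (x m) - g (x m.+1)).
  by rewrite x_cgd; apply: sweep_descent.
have mono m : g (x m) <= g (x 0%N).
  elim: m => // m; apply: le_trans; rewrite -subr_ge0.
  have := le_trans (sqr_ge0 _) (desc m).
  by rewrite pmulr_rge0// mulr_gt0.
(* By [mono] the iterates stay in the initial level set, and finiteness of the radius makes [D] an
   upper bound. *)
have dist m : enorm (x m - xs) <= D.
  by apply: ub_le_sup => //; exists (x m), xs; split.
have D0 : 0 <= D := le_trans (enorm_ge0 _) (dist 0%N).
(* Multiplying by [m] instead of dividing lets the induction start at 0, where nothing is claimed
   about the initial gap. *)
have rate m : m%:R * (g (x m) - g xs) <= 2 * M * D ^+ 2.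
  elim: m => [|m IH].
    by rewrite mul0r !mulr_ge0 ?sqr_ge0// ltW.
  rewrite -natr1; apply: (@rate_step _ M D (enorm (gradient g (x m.+1)))
    (g (x m) - g xs)) => //; rewrite ?enorm_ge0 ?subr_ge0 ?xsmin//.
  - have quad v := minimizer_quadratic_bound v g_diff2 P_gt0 hP H_bound xsmin.
    apply: le_trans (minimizer_gap_le g_convex (g_diff2.1 _) M0 quad) _.
    by rewrite lerD2r ler_wpM2r ?enorm_ge0.
  - by rewrite opprB addrA subrK.
by rewrite mulrA ler_pdivlMr ?ltr0n// mulrC.
Qed.
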